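(* Let $b_nn\in\{1,\dots,n\}$ for each $n$ and assume that $\lim_{n\to\infty}b_n=b\in[0,1]$. Under $p_n(\mathrm{id},\cdot)$, let $\sigma^{-1}_{b_nn}$ denote the position of card number $b_nn$. Then the weak limit, as $n\to\infty$, of the distribution of $\frac1n\sigma^{-1}_{b_nn}$ exists. Its distribution function $$F_b(x)\equiv\lim_{n\to\infty}p_n(\mathrm{id},\{\sigma^{-1}_{b_nn}\le xn\}),\quad x\in[0,1],$$ is given as follows. Define $G_b:[0,1]\to[0,1]$ by $$G_b(y)=\begin{cases} ye^{1-b}, & 0\le y\le 1-(1-b)e^b;\\ e^{(1-y)e^{-b}}-(1-y)e^{1-b}, & 1-(1-b)e^b\le y\le 1.\end{cases}$$ Then $F_b=G_b^{-1}$ (the inverse function of $G_b$).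
   Context: A permutation $\sigma\in S_n$ is viewed as a deck of cards numbered $1,\dots,n$ laid out in a row, where $\sigma_j$ is the number of the card in the $j$-th position from the left; thus $\sigma^{-1}_i$ is the position of the card numbered $i$. The card-cyclic to random insertion shuffle removes each of the $n$ cards exactly once and immediately reinserts it in a position chosen uniformly from the $n$ possible positions (independently of the other insertions); the removals and reinsertions are performed one card at a time in the original left-to-right order of the cards. Starting from the identity $\mathrm{id}$ (cards in increasing order from left to right), the cards are thus removed and reinserted in the order $1,2,\dots,n$, and after card $j$ is reinserted in ''position $k$'' it is the $k$-th card from the left. $p_n(\mathrm{id},\cdot)$ denotes the distribution on $S_n$ of the deck after one such shuffle started from $\mathrm{id}$. *)

(* Defs.v *)
From HB Require Import structures.
From mathcomp Require Import all_boot all_order all_algebra all_fingroup.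
From mathcomp Require Import all_classical all_reals all_analysis.

Set Implicit Arguments.
Unset Strict Implicit.
Unset Printing Implicit Defensive.

Import Order.TTheory GRing.Theory Num.Theory.
Import numFieldNormedType.Exports.

Local Open Scope classical_set_scope.
Local Open Scope ring_scope.

(* Cards and positions are numbered from 0: the card (or position) called
   1 + i in the usual numbering is i : 'I_n.+1.  A deck of n.+1 cards is
   s : 'S_n.+1, where s j is the card in position j from the left, so that
   s^-1 c is the position of the card c. *)

(* {perm T} and 'S_n unfold to perm_type, which carries the instances. *)
HB.instance Definition _ (T : finType) :=
  isPointed.Build (perm_type T) (1%g : {perm T}).

HB.instance Definition _ (T : finType) :=
  @isMeasurable.Build default_measure_display (perm_type T)
    discrete_measurable discrete_measurable0 discrete_measurableC
    discrete_measurableU.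

(* lift_perm k p 1 sends k to p and the i-th index other than k to the i-th
   index other than p; permutations compose from left to right, so this is
   the deck with c in position k and the other cards, in unchanged relative
   order, in the other positions. *)
Definition reinsert (n : nat) (c k : 'I_n.+1) (s : 'S_n.+1) : 'S_n.+1 :=
  (lift_perm k ((s^-1)%g c) 1 * s)%g.

(* One round started from s; the j-th card of s is the j-th one to be
   removed, and f j is the position at which it is reinserted. *)
Definition shuffle (n : nat) (s : 'S_n.+1) (f : {ffun 'I_n.+1 -> 'I_n.+1}) :
    'S_n.+1 :=
  foldl (fun t j => reinsert (s j) (f j) t) s (enum 'I_n.+1).

(* The transition law p_(n.+1) (s, .): the law of shuffle s f for f uniform,
   i.e. for independent uniform insertion positions. *)
Definition card_cyclic (R : realType) (n : nat) (s : 'S_n.+1)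
    (A : set 'S_n.+1) : \bar R :=
  \sum_(f : {ffun 'I_n.+1 -> 'I_n.+1})
    (#|{ffun 'I_n.+1 -> 'I_n.+1}|%:R^-1)%:E * \d_(shuffle s f) A.

Section card_cyclic_probability.
Local Open Scope ereal_scope.
Context (R : realType) (n : nat) (s : 'S_n.+1).

Let card_cyclic0 : card_cyclic R s set0 = 0.
Proof.
by rewrite /card_cyclic big1// => f _; rewrite measure0 mule0.
Qed.

Let card_cyclic_ge0 A : 0 <= card_cyclic R s A.
Proof.
by apply: sume_ge0 => f _; rewrite mule_ge0// lee_fin invr_ge0.
Qed.

Let card_cyclic_sigma_additive : semi_sigma_additive (card_cyclic R s).
Proof.
move=> F mF tF mUF.
have -> : card_cyclic R s (\bigcup_k F k) =
    \sum_(0 <= k <oo) card_cyclic R s (F k).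
  rewrite /card_cyclic nneseries_sum; last first.
    by move=> f k _; rewrite mule_ge0// lee_fin invr_ge0.
  apply: eq_bigr => f _; rewrite nneseriesZl//.
  congr (_ * _); apply/esym/cvg_lim => //.
  exact: (@measure_semi_sigma_additive _ _ _ (\d_(shuffle s f)) F).
by apply: is_cvg_nneseries => k _ _; exact: card_cyclic_ge0.
Qed.

HB.instance Definition _ := isMeasure.Build _ _ _ (card_cyclic R s)
  card_cyclic0 card_cyclic_ge0 card_cyclic_sigma_additive.

Let card_cyclic_setT : card_cyclic R s setT = 1.
Proof.
rewrite /card_cyclic (eq_bigr (fun=> (#|{ffun 'I_n.+1 -> 'I_n.+1}|%:R^-1)%:E)).
  rewrite sumEFin sumr_const; congr _%:E.
  rewrite -[LHS]mulr_natl mulfV// pnatr_eq0 -lt0n.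
  by apply/card_gt0P; exists [ffun=> ord0].
by move=> f _; rewrite diracT mule1.
Qed.

HB.instance Definition _ := Measure_isProbability.Build _ _ _
  (card_cyclic R s) card_cyclic_setT.

End card_cyclic_probability.

(* 1-based, hence the successor *)
Definition position (n : nat) (c : 'I_n.+1) (s : 'S_n.+1) : nat :=
  ((s^-1)%g c).+1.

Definition scaled_position (R : realType) (n : nat) (c : 'I_n.+1)
    (s : 'S_n.+1) : R := (position c s)%:R / n.+1%:R.

HB.instance Definition _ (R : realType) (n : nat) (c : 'I_n.+1) :=
  @isMeasurableFun.Build _ _ (perm_type 'I_n.+1) R
    (@scaled_position R n c) (fun _ _ _ => I).

Definition weak_cvg (R : realType)
    (mu_ : nat -> probability R R)
    (mu : probability R R) : Prop :=
  forall f : R -> R, continuous f -> bounded_fun f ->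
    (\int[mu_ n]_x (f x)%:E)%E @[n --> \oo] --> (\int[mu]_x (f x)%:E)%E.

(* the two expressions agree at the junction y = 1 - (1 - b) * expR b *)
Definition G (R : realType) (b y : R) : R :=
  if y <= 1 - (1 - b) * expR b then y * expR (1 - b)
  else expR ((1 - y) * expR (- b)) - (1 - y) * expR (1 - b).

(* Main.v *)
(** A card that is in position P (counted from 1) while another card is removed
from its left and reinserted moves on average to (P - 1) * a, and to P * a if
the removed card comes from its right, where a = 1 + 1/N for a deck of N cards.
Hence a suitable normalization of the position is a martingale with increments
of size O(1), and its fourth moment shows that positions stay within o(N) of
the solution of x' = x - 1 (removals from the left), then x' = x (removals from
the right), simultaneously for all cards.

Before its own move the card b N is thus in position N (1 - (1 - b) e^b), and a
card u N still to be moved is in position N (1 - (1 - u) e^b). Once b N is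
inserted in position y N, the cards to be moved from its left are those with
1 - (1 - u) e^b < y, and following the two equations gives the final position
N G_b(y). As y is uniform and G_b is increasing, the limiting distribution
function is the inverse of G_b. *)

Require Import Defs.
From HB Require Import structures.
From mathcomp Require Import all_boot all_order all_algebra all_fingroup.
From mathcomp Require Import all_classical all_reals all_analysis.
From mathcomp Require Import measurable_realfun ring lra zify.

Set Implicit Arguments.
Unset Strict Implicit.
Unset Printing Implicit Defensive.

Import Order.TTheory GRing.Theory Num.Theory.
Import numFieldNormedType.Exports.

Local Open Scope classical_set_scope.
Local Open Scope ring_scope.

(** * Means over finite sets and martingales *)

Definition mean (R : realType) (T : finType) (g : T -> R) : R :=
  (#|T|%:R)^-1 * \sum_x g x.

Section mean.
Context {R : realType} {T : finType}.
Implicit Types g h : T -> R.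

Lemma le_mean g h : (forall x, g x <= h x) -> mean g <= mean h.
Proof. by move=> gh; rewrite ler_wpM2l ?invr_ge0// ler_sum. Qed.

Lemma eq_mean g h : g =1 h -> mean g = mean h.
Proof. by move=> gh; congr (_ * _); apply: eq_bigr. Qed.

Lemma meanD g h : mean (fun x => g x + h x) = mean g + mean h.
Proof. by rewrite /mean big_split mulrDr. Qed.

Lemma meanZ (k : R) g : mean (fun x => k * g x) = k * mean g.
Proof. by rewrite /mean -mulr_sumr mulrCA. Qed.

Lemma mean_sum (I : Type) (r : seq I) (P : pred I) (g : I -> T -> R) :
  mean (fun x => \sum_(i <- r | P i) g i x) = \sum_(i <- r | P i) mean (g i).
Proof. by rewrite /mean exchange_big -mulr_sumr. Qed.

Lemma mean_cst (x0 : T) (k : R) : mean (fun _ : T => k) = k.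
Proof.
rewrite /mean sumr_const -[k *+ _]mulr_natl mulrA mulVf ?mul1r// pnatr_eq0 -lt0n.
by apply/card_gt0P; exists x0.
Qed.

Lemma mean_indicator_le1 (x0 : T) (P : pred T) : mean (fun x => (P x)%:R) <= 1 :> R.
Proof.
by rewrite -[leRHS](mean_cst x0); apply: le_mean => x; case: (P x).
Qed.

Lemma markov4 g (t : R) : 0 < t ->
  mean (R := R) (fun x => (t <= `|g x|)%R%:R) <= mean (fun x => g x ^+ 4) / t ^+ 4.
Proof.
move=> t0; rewrite mulrC -meanZ; apply: le_mean => x.
have [tg|tg] /= := leP t `|g x|; last first.
  by rewrite mulr_ge0 ?invr_ge0 ?exprn_even_ge0// exprn_ge0// ltW.
rewrite ler_pdivlMl ?exprn_gt0// mulr1.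
rewrite -[leRHS]ger0_norm ?exprn_even_ge0// normrX.
by rewrite ler_pXn2r// nnegrE// ltW.
Qed.

End mean.

(** * Resampling one coordinate of a uniform function *)

Section resampling.
Context {R : realType} {n : nat}.
Local Notation I := 'I_n.+1.
Local Notation Om := {ffun I -> I}.
Let f0 : Om := [ffun=> ord0].

Definition upd (f : Om) (j i : I) : Om := [ffun x => if x == j then i else f x].

(** Adding [i] modulo [n.+1] to coordinate [j] is a bijection of [Om], so each shifted copy of [g]
    has the same mean; averaging over [i] gives the identity. It stands in for conditioning on the
    other coordinates. *)
Lemma mean_upd (j : I) (g : Om -> R) :
  mean g = mean (fun f => mean (fun i : I => g (upd f j i))).
Proof.
have shiftE (i : I) : mean (fun f => g (upd f j (f j + i)%R)) = mean g.
  congr (_ * _).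
  rewrite [RHS](reindex (fun f : Om => upd f j (f j + i)%R))//=.
  exists (fun f : Om => upd f j (f j - i)%R) => f _; apply/ffunP => x;
    rewrite !ffunE eqxx; case: eqVneq => [->|//].
    by rewrite addrK.
  by rewrite subrK.
have -> : (fun f => mean (fun i : I => g (upd f j i))) =
    (fun f => mean (fun i : I => g (upd f j (f j + i)%R))).
  apply/funext => f; congr (_ * _).
  rewrite [LHS](reindex (fun i : I => f j + i)%R)//=.
  by exists (fun i => i - f j)%R => i _; [rewrite addrC addKr|rewrite addrC subrK].
transitivity (mean (fun i : I => mean g)); first by rewrite (mean_cst j).
under eq_mean => i do rewrite -(shiftE i).
by rewrite /mean -!mulr_sumr exchange_big mulrCA.
Qed.

Lemma mean_proj (j : I) (g : I -> R) : mean (fun f : Om => g (f j)) = mean g.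
Proof.
rewrite (mean_upd j) -[RHS](mean_cst f0); apply: eq_mean => f.
by apply: eq_mean => i; rewrite ffunE eqxx.
Qed.

Section martingale.
(** Coordinate [j] is the fresh randomness of step [j]: invariance under [upd] replaces
    measurability for a filtration, and averaging over one coordinate replaces conditional
    expectation. *)
Variables (Y : nat -> Om -> R) (p q : nat).
Hypothesis Yadapted : forall j k f i, (p <= k <= j)%N -> (j < q)%N ->
  Y k (upd f (inord j) i) = Y k f.
Hypothesis Ymart : forall j f, (p <= j < q)%N ->
  mean (fun i => Y j.+1 (upd f (inord j) i)) = Y j f.
Hypothesis Yincr : forall j f, (p <= j < q)%N -> `|Y j.+1 f - Y j f| <= 1.

Let S j f := Y j f - Y p f.

Let S_upd j f i (D := Y j.+1 (upd f (inord j) i) - Y j f) :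
  (p <= j < q)%N -> S j.+1 (upd f (inord j) i) = S j f + D /\ `|D| <= 1.
Proof.
move=> /andP[pj jq]; split.
  by rewrite /S /D (@Yadapted j p) ?leqnn ?pj//; ring.
rewrite /D -(@Yadapted j j f i) ?leqnn ?pj//.
by apply: Yincr; rewrite pj.
Qed.

Let meanD0 j f : (p <= j < q)%N ->
  mean (fun i => Y j.+1 (upd f (inord j) i) - Y j f) = 0.
Proof.
by move=> pjq; rewrite meanD Ymart// (mean_cst ord0) subrr.
Qed.

Let second_moment k : (p + k <= q)%N -> mean (fun f => S (p + k) f ^+ 2) <= k%:R.
Proof.
elim: k => [_|k IH pkq].
  rewrite addn0 /S; under eq_mean => f do rewrite subrr expr0n /=.
  by rewrite (mean_cst f0).
have pjq : (p <= p + k < q)%N by rewrite leq_addr -addnS.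
rewrite addnS (mean_upd (inord (p + k))).
apply: (@le_trans _ _ (mean (fun f => S (p + k) f ^+ 2 + 1))).
  apply: le_mean => f.
  (* The cross term of the square averages to zero; adding it on the right makes the inequality true
     for each [i] separately. *)
  rewrite -[leRHS]addr0 -[X in _ + X](mulr0 (2 * S (p + k) f)) -(meanD0 f pjq).
  rewrite -meanZ -[X in _ <= X + _](mean_cst (ord0 : I)) -meanD.
  apply: le_mean => i.
  have [-> D1] := S_upd f i pjq.
  set D := Y _ _ - _ in D1 *.
  move: D1; rewrite ler_norml => /andP[? ?]; nra.
rewrite meanD (mean_cst f0) -natr1 lerD2r IH//.
by rewrite addnS in pkq; exact: ltnW.
Qed.

(** One step adds at most 8 S^2 + 3 to the mean of S^4, the term linear in the increment having mean
    zero. With [second_moment] the induction closes, as 4 k^2 + 8 k + 3 <= 4 (k + 1)^2. Fourth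
    moments are used because their Markov bound still tends to zero after summation over all
    cards. *)
Lemma martingale_fourth_moment k : (p + k <= q)%N ->
  mean (fun f => (Y (p + k) f - Y p f) ^+ 4) <= 4 * k%:R ^+ 2.
Proof.
elim: k => [_|k IH pkq].
  rewrite addn0; under eq_mean => f do rewrite subrr expr0n /=.
  by rewrite (mean_cst f0) expr0n mulr0.
have pjq : (p <= p + k < q)%N by rewrite leq_addr -addnS.
have pkq' : (p + k <= q)%N by rewrite addnS in pkq; exact: ltnW.
rewrite addnS (mean_upd (inord (p + k))).
apply: (@le_trans _ _ (mean (fun f => S (p + k) f ^+ 4 + (8 * S (p + k) f ^+ 2 + 3)))).
  apply: le_mean => f.
  rewrite -[leRHS]addr0 -[X in _ + X](mulr0 (4 * S (p + k) f ^+ 3)) -(meanD0 f pjq).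
  rewrite -meanZ -[X in _ <= X + _](mean_cst (ord0 : I)) -meanD.
  apply: le_mean => i; rewrite -/(S _ _).
  have [-> D1] := S_upd f i pjq.
  set D := Y _ _ - _ in D1 *.
  move: (S _ f) D1 => s; move: D => D; rewrite ler_norml => /andP[D1 D2].
  have D21 : D ^+ 2 <= 1 by nra.
  have -> : (s + D) ^+ 4 = s ^+ 4 + 4 * s ^+ 3 * D + 6 * s ^+ 2 * D ^+ 2
     + 4 * (s * D) * D ^+ 2 + (D ^+ 2) ^+ 2 by ring.
  (* The cubic term is absorbed using 2 (s - D)^2 D^2 >= 0, which leaves 8 s^2 D^2 + 3 D^4. *)
  have h1 : 4 * (s * D) * D ^+ 2 <= 2 * s ^+ 2 * D ^+ 2 + 2 * D ^+ 2 * D ^+ 2.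
    rewrite -subr_ge0; have -> : 2 * s ^+ 2 * D ^+ 2 + 2 * D ^+ 2 * D ^+ 2 -
      4 * (s * D) * D ^+ 2 = 2 * (s - D) ^+ 2 * D ^+ 2 by ring.
    by rewrite mulr_ge0 ?sqr_ge0// mulr_ge0 ?sqr_ge0.
  have s2 := sqr_ge0 s; have d2 := sqr_ge0 D.
  move: (D ^+ 2) (s ^+ 2) D21 s2 d2 h1 => d ss; nra.
rewrite meanD meanD meanZ (mean_cst f0).
have := IH pkq'; have := second_moment pkq'; rewrite -natr1 /S; nra.
Qed.

End martingale.
End resampling.

(** * Positions of the cards *)

Section deck.
Context {n : nat}.
Local Notation I := 'I_n.+1.
Local Notation Om := {ffun I -> I}.
Implicit Types (f : Om) (u v i : I) (j k : nat).

(** Recursive form of the fold in [shuffle], which gives access to the order after the first [j]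
    moves. Only [j <= n.+1] is meaningful, since [inord] sends larger numbers to card 0. *)
Fixpoint deck f j : 'S_n.+1 :=
  if j is j'.+1 then reinsert (inord j') (f (inord j')) (deck f j') else 1%g.

Lemma shuffle_deck f : shuffle 1 f = deck f n.+1.
Proof.
have enumE : enum I = [seq inord j | j <- iota 0 n.+1].
  rewrite -val_enum_ord -map_comp -[LHS]map_id; apply: eq_map => i /=.
  by rewrite inord_val.
suff foldE m : foldl (fun t (j : I) => reinsert ((1%g : 'S_n.+1) j) (f j) t) 1%g
    [seq inord j | j <- iota 0 m] = deck f m by rewrite /shuffle enumE foldE.
elim: m => // m IH.
have -> : iota 0 m.+1 = iota 0 m ++ [:: m] by rewrite -addn1 iotaD.
by rewrite map_cat foldl_cat IH /= perm1.
Qed.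

Definition loc f j u : nat := ((deck f j)^-1)%g u.

Lemma lift_perm1MV (k p : I) (s : 'S_n.+1) u : ((lift_perm k p 1 * s)^-1)%g u =
  lift_perm p k 1 ((s^-1)%g u).
Proof. by rewrite invMg lift_permV invg1 permM. Qed.

Lemma loc0 f u : loc f 0 u = u.
Proof. by rewrite /loc /= invg1 perm1. Qed.

Lemma loc_self f j : loc f j.+1 (inord j) = f (inord j).
Proof. by rewrite /loc /= /reinsert lift_perm1MV lift_perm_id. Qed.

(** Removing the moved card closes the gap at its old place ([unbump]), and its insertion opens one
    at the new place ([bump]). *)
Lemma loc_step f j u : u != inord j ->
  loc f j.+1 u = bump (f (inord j)) (unbump (loc f j (inord j)) (loc f j u)).
Proof.
move=> uj; rewrite /loc /= /reinsert lift_perm1MV.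
have : (deck f j)^-1%g (inord j) != (deck f j)^-1%g u.
  by rewrite (inj_eq perm_inj) eq_sym.
by case/unlift_some => q -> _; rewrite lift_perm_lift perm1 /= bumpK.
Qed.

Lemma loc_inj f j u v : loc f j u = loc f j v -> u = v.
Proof. by move=> /val_inj /perm_inj. Qed.

Lemma loc_lt f j u : (loc f j u < n.+1)%N.
Proof. exact: ltn_ord. Qed.

(** [unbump] merges two places only if one of them is the vacated place, where neither [u] nor [v]
    is. *)
Lemma loc_step_lt f j u v : u != inord j -> v != inord j ->
  (loc f j.+1 u < loc f j.+1 v)%N = (loc f j u < loc f j v)%N.
Proof.
move=> uj vj; rewrite !loc_step// !ltnNge leq_bump2; congr negb.
have /eqP : loc f j u != loc f j (inord j).
  by apply: contra uj => /eqP /loc_inj /eqP.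
have /eqP : loc f j v != loc f j (inord j).
  by apply: contra vj => /eqP /loc_inj /eqP.
by rewrite /unbump; lia.
Qed.

Lemma neq_inord j u : (j < u)%N -> u != inord j.
Proof.
move=> ju; have jn := ltn_trans ju (ltn_ord u).
by apply: contraTneq ju => ->; rewrite inordK// ltnn.
Qed.

Lemma loc_unmoved f j u v : (j <= u)%N -> (u < v)%N -> (loc f j u < loc f j v)%N.
Proof.
move=> + uv; elim: j => [|j IH] ju; first by rewrite !loc0.
by rewrite loc_step_lt ?IH ?neq_inord// ?(ltn_trans ju)// ltnW.
Qed.

(** Neither card moves between the insertion of [c] and the removal of [u], so the side of [c] from
    which [u] will be taken is decided when [c] is inserted. *)
Lemma loc_relative f (c : I) j u : (c < j <= u)%N ->
  (loc f j c < loc f j u)%N = (loc f c.+1 c < loc f c.+1 u)%N.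
Proof.
elim: j => // j IH /andP[cj ju]; have [->//|cj'] := eqVneq (c : nat) j.
have cltj : (c < j)%N by rewrite ltn_neqAle cj' -ltnS.
rewrite loc_step_lt ?(neq_inord ju)//; last first.
  apply: contraNneq cj' => ->; rewrite inordK//.
  exact: ltn_trans ju (ltn_ord u).
by rewrite IH// cltj ltnW.
Qed.

(** Adaptedness: the first [k] moves read only coordinates below [k]. *)
Lemma deck_upd f j k i : (k <= j)%N -> (j < n.+1)%N ->
  deck (upd f (inord j) i) k = deck f k.
Proof.
elim: k => //= k IH kj jn; rewrite IH ?(ltnW kj)// ffunE.
case: eqVneq => // /(congr1 (@nat_of_ord _)); rewrite !inordK//.
  by move=> kE; rewrite kE ltnn in kj.
exact: ltn_trans jn.
Qed.

Lemma loc_upd f j k i u : (k <= j)%N -> (j < n.+1)%N ->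
  loc (upd f (inord j) i) k u = loc f k u.
Proof. by move=> kj jn; rewrite /loc deck_upd. Qed.

Lemma loc_upd_step f j i u : (j < n.+1)%N -> u != inord j ->
  loc (upd f (inord j) i) j.+1 u =
  bump i (unbump (loc f j (inord j)) (loc f j u)).
Proof. by move=> jn uj; rewrite loc_step// !loc_upd// ffunE eqxx. Qed.

Section first_right.
Variable c : I.

(* The cards after c, which are the ones still to be moved once c is inserted,
   are in increasing order, so those lying to the right of c are the ones from
   first_right f on (none if first_right f = n.+1). *)
Definition first_right f : nat :=
  find (fun x => (c < x) && (loc f c.+1 c < loc f c.+1 (inord x)))%N
    (iota 0 n.+1).

Lemma first_right_le f : (first_right f <= n.+1)%N.
Proof. by rewrite -[leqRHS](size_iota 0 n.+1) find_size. Qed.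

Let first_rightP f : (first_right f < n.+1)%N ->
  (c < first_right f)%N /\
  (loc f c.+1 c < loc f c.+1 (inord (first_right f)))%N.
Proof.
move=> fn; have := fn; rewrite -[X in (_ < X)%N](size_iota 0 n.+1) -has_find.
by move=> /(nth_find 0%N); rewrite nth_iota// add0n => /andP.
Qed.

Lemma first_right_gt f : (c < first_right f)%N.
Proof.
have [fn|fn] := ltnP (first_right f) n.+1; first by case: (first_rightP fn).
by rewrite (leq_trans _ fn).
Qed.

(** The cards after [c] are still in increasing order, so lying to the right of [c] passes on to all
    larger cards. *)
Lemma first_rightE f u : (c < u)%N ->
  (loc f c.+1 c < loc f c.+1 u)%N = (first_right f <= u)%N.
Proof.
move=> cu; apply/idP/idP => [cltu|fu].
  rewrite leqNgt; apply/negP => /(before_find 0%N).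
  by rewrite nth_iota// add0n cu inord_val cltu.
have fn := leq_ltn_trans fu (ltn_ord u).
have [cf /leq_trans] := first_rightP fn; apply.
have [fE|fu'] := eqVneq (first_right f) u; first by rewrite fE inord_val.
by rewrite ltnW// loc_unmoved// inordK// ltn_neqAle fu'.
Qed.

Lemma first_right_upd f j i : (c < j)%N -> (j < n.+1)%N ->
  first_right (upd f (inord j) i) = first_right f.
Proof.
by move=> cj jn; apply: eq_find => x; rewrite !loc_upd.
Qed.

(* Inserting c in position f c puts it to the left of exactly those later cards
   that were at position at least (f c).+1 before c was removed. *)
Lemma first_right_loc f u : (c < u)%N ->
  (first_right f <= u)%N = (f c < loc f c u)%N.
Proof.
move=> cu; rewrite -first_rightE//.
have := loc_self f c; rewrite inord_val => ->.
rewrite loc_step ?neq_inord// inord_val.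
by have := @loc_unmoved f c c u (leqnn c) cu; rewrite /bump /unbump; lia.
Qed.

End first_right.
End deck.

(** * Martingales that follow the position of a card *)

Section position_martingales.
Context {R : realType} {n : nat}.
Local Notation I := 'I_n.+1.
Local Notation Om := {ffun I -> I}.
Local Notation N := (n.+1%:R).
Implicit Types (f : Om) (u i c : I) (j k : nat).

Definition growth : R := 1 + N^-1.
Local Notation a := growth.

Lemma growth_ge1 : 1 <= a. Proof. by rewrite lerDl invr_ge0. Qed.

Lemma growth_gt0 : 0 < a. Proof. exact: lt_le_trans growth_ge1. Qed.

Let N0 : 0 < N :> R. Proof. by rewrite ltr0n. Qed.

(** With the moved card taken out, a card at [q] is shifted exactly by the q + 1 insertions at
    [i <= q]. *)
Lemma mean_bump (q : nat) : (q <= n)%N ->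
  mean (fun i => (bump i q)%:R) = q%:R + (q%:R + 1) / N :> R.
Proof.
move=> qn; rewrite /bump.
under eq_mean => i do rewrite natrD addrC.
rewrite meanD (mean_cst (ord0 : I)); congr (_ + _).
rewrite /mean card_ord mulrC; congr (_ / _).
rewrite -natr_sum natr1; congr _%:R.
under eq_bigr => i _ do rewrite -ltnS.
rewrite (eq_bigr (fun i : I => if (i < q.+1)%N then 1 else 0)%N); last first.
  by move=> i _; case: ifP.
by rewrite -big_mkcond -(big_ord_widen _ (fun=> 1%N))// sum1_card card_ord.
Qed.

(** The increment is [w] times the difference of a 0-1 indicator and its mean, hence at most 1 in
    absolute value, and [mean_bump] gives the martingale property. *)
Lemma bump_fourth_moment (Y : nat -> Om -> R) (p q : nat) :
    (forall j k f i, (p <= k <= j)%N -> (j < q)%N ->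
      Y k (upd f (inord j) i) = Y k f) ->
    (forall j f, (p <= j < q)%N -> exists (x : nat) (V w : R),
      [/\ (x <= n)%N, `|w| <= 1,
          forall i, Y j.+1 (upd f (inord j) i) = V + w * (bump i x)%:R
        & Y j f = V + w * (x%:R + (x%:R + 1) / N)]) ->
  forall k, (p + k <= q)%N ->
  mean (fun f => (Y (p + k) f - Y p f) ^+ 4) <= 4 * k%:R ^+ 2.
Proof.
move=> Yadapted Ystep; apply: martingale_fourth_moment => // j f jpq;
  have [x [V [w [xn w1 Y1 Y0]]]] := Ystep j f jpq.
  by rewrite (eq_mean Y1) meanD (mean_cst (ord0 : I)) meanZ mean_bump.
(* Any [f] is the update of itself at [j] by its own value, so the increment at [f] is an instance
   of [Y1]. *)
have fE : upd f (inord j) (f (inord j)) = f.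
  by apply/ffunP => y; rewrite ffunE; case: eqVneq => [->|].
have := Y1 (f (inord j)); rewrite fE Y0 => ->.
rewrite opprD addrACA subrr add0r -mulrBr normrM mulr_ile1//.
have z0 : 0 <= (x%:R + 1) / N :> R by rewrite divr_ge0// addr_ge0.
have z1 : (x%:R + 1) / N <= 1 :> R.
  by rewrite ler_pdivrMr// mul1r natr1 ler_nat.
rewrite /bump natrD; move: ((x%:R + 1) / N) z0 z1 => z z0 z1; rewrite ler_norml.
by case: (_ <= x)%N => /=; apply/andP; split; lra.
Qed.

(** A card at [q.+1] drops to [q] when a card on its left is removed; the right side is [N] minus
    its mean position after the reinsertion. *)
Let growth_step (q : nat) : (q <= n)%N ->
  (N - q.+1%:R) * a = N - (q%:R + (q%:R + 1) / N).
Proof.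
rewrite /growth -[q.+1%:R]natr1; move: (q%:R) N0 => x; move: N => M M0 _.
by field; rewrite gt_eqF.
Qed.

(* Until the move of u every moved card comes from the left of u, so that the
   number n.+1 - loc f j u of positions from u on is multiplied on average by a
   at each step. *)
Lemma unmoved_fourth_moment k u : (k <= u)%N ->
  mean (fun f => ((N - (loc f k u)%:R) / a ^+ k - (N - u%:R)) ^+ 4)
    <= 4 * N ^+ 2.
Proof.
move=> ku; pose Y j f : R := (N - (loc f j u)%:R) / a ^+ j.
have kn : (k <= n.+1)%N by rewrite ltnW// (leq_ltn_trans ku).
have a0 := growth_gt0; have a1 := growth_ge1.
apply: (@le_trans _ _ (4 * k%:R ^+ 2)); last first.
  by rewrite ler_pM2l// ler_sqr ?nnegrE// ler_nat.
have Y0 f : Y 0 f = N - u%:R by rewrite /Y loc0 expr0 divr1.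
under eq_mean => f do rewrite -(Y0 f) -/(Y k f).
apply: (@bump_fourth_moment Y 0 k _ _ k) => //.
  by move=> j l f i lj jk; rewrite /Y loc_upd// (leq_trans jk).
move=> j f jk; have {}jk : (j < k)%N by [].
have ju := leq_trans jk ku; have jn := ltn_trans ju (ltn_ord u).
(* Card [j] lies to the left of [u], so [u] is not at place 0, and [x] is its place once card [j] is
   removed. *)
have := @loc_unmoved _ f j (inord j) u; rewrite inordK// => /(_ (leqnn _) ju).
have := loc_lt f j u; case E : (loc f j u) => [//|x] xn jx.
exists x, (N / a ^+ j.+1), (- (a ^+ j.+1)^-1); split.
- exact: ltnW.
- have aj0 : 0 < a ^+ j.+1 by rewrite exprn_gt0.
  by rewrite normrN gtr0_norm ?invr_gt0// invf_le1// exprn_ege1.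
- move=> i; rewrite /Y loc_upd_step ?neq_inord// E /unbump jx subn1 /=; ring.
transitivity ((N - (x%:R + (x%:R + 1) / N)) / a ^+ j.+1); last by ring.
rewrite /Y E -growth_step; last exact: ltnW.
by rewrite exprS invfM mulrA mulfK// gt_eqF.
Qed.

(* Once c is inserted, the moved cards first come from the left of c, and then,
   from the card first_right c f on, from its right. *)
Lemma inserted_fourth_moment c :
  mean (fun f => ((loc f n.+1 c).+1%:R / a ^+ n.+1 -
      ((N + 1) * a ^+ (n.+1 - first_right c f) - (N - (f c)%:R) * a ^+ (n - c)) /
      a ^+ n.+1) ^+ 4)
    <= 4 * N ^+ 2.
Proof.
have a0 := growth_gt0; have a1 := growth_ge1.
(* [Y] is the predicted final 1-based position over [a ^+ n.+1]. Before time [first_right c f] the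
   quantity [N - loc] grows by the factor [a] on average, afterwards [loc + 1] does; the two regimes
   fit together since (N + 1) - (N - loc) = loc + 1. The division keeps the coefficients [w] at most
   1. *)
pose Y j f : R := ((N + 1) * a ^+ (n.+1 - maxn j (first_right c f)) -
   (N - (loc f j c)%:R) * a ^+ (n.+1 - j)) / a ^+ n.+1.
apply: (@le_trans _ _ (4 * (n - c)%:R ^+ 2)); last first.
  by rewrite ler_pM2l// ler_sqr ?nnegrE// ler_nat (leq_trans (leq_subr _ _)).
have cn : (c.+1 + (n - c) = n.+1)%N by rewrite addSn subnKC// -ltnS ltn_ord.
have Y1 f : Y (c.+1 + (n - c))%N f = (loc f n.+1 c).+1%:R / a ^+ n.+1.
  rewrite cn /Y (maxn_idPl (first_right_le c f)) subnn expr0 !mulr1 -[in RHS]natr1.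
  by congr (_ / _); ring.
have Y0 f : Y c.+1 f = ((N + 1) * a ^+ (n.+1 - first_right c f) -
    (N - (f c)%:R) * a ^+ (n - c)) / a ^+ n.+1.
  rewrite /Y (maxn_idPr (first_right_gt c f)) subSS.
  by have := loc_self f c; rewrite inord_val => ->.
under eq_mean => f do rewrite -Y0 -Y1.
apply: (@bump_fourth_moment Y c.+1 n.+1); last by rewrite cn.
  move=> j k f i /andP[ck kj] jn; rewrite /Y loc_upd// first_right_upd//.
  exact: leq_trans kj.
move=> j f /andP[cj jn]; have jI : @inord n j = j :> nat by rewrite inordK.
have cNj : c != inord j.
  by apply: contraTneq cj => ->; rewrite jI ltnn.
have wE : a ^+ (n.+1 - j) = a * a ^+ (n.+1 - j.+1).
  by rewrite -exprS subSn.
have w1 : `|a ^+ (n.+1 - j.+1) / a ^+ n.+1| <= 1.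
  rewrite gtr0_norm ?divr_gt0 ?exprn_gt0// ler_pdivrMr ?exprn_gt0// mul1r.
  by rewrite ler_weXn2l// leq_subr.
(* The case split tells on which side of [c] the card [j] lies when it is removed. The witness for
   [x] is the place of [c] after that removal: unchanged if [j] was on the right, one less if it was
   on the left. *)
have := @first_rightE _ c f (inord j); rewrite jI => /(_ cj).
rewrite -(@loc_relative _ f c j) ?jI ?leqnn ?cj//.
have := loc_lt f j c; have [jr|jl] := leqP (first_right c f) j => xn lt_cj.
- exists (loc f j c), ((N + 1 - N) * a ^+ (n.+1 - j.+1) / a ^+ n.+1),
    (a ^+ (n.+1 - j.+1) / a ^+ n.+1); split => //.
    move=> i; rewrite /Y first_right_upd// loc_upd_step// (maxn_idPl (leqW jr)).
    by rewrite /unbump ltnNge ltnW ?lt_cj//= subn0; ring.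
  rewrite /Y (maxn_idPl jr) wE; move: (a ^- _) (a ^+ (_ - _)) => A w.
  rewrite /growth; move: ((loc f j c)%:R) N0 => y; move: N => M M0.
  by field; rewrite gt_eqF.
- have := lt_cj; have : loc f j c != loc f j (inord j).
    by apply: contra cNj => /eqP /loc_inj /eqP.
  case E : (loc f j c) xn => [|x] xn xNj /negbT; rewrite -leqNgt => xj.
    by move: xNj; rewrite eq_sym -leqn0 xj.
  exists x, ((N + 1) * a ^+ (n.+1 - first_right c f) / a ^+ n.+1 -
    N * a ^+ (n.+1 - j.+1) / a ^+ n.+1),
    (a ^+ (n.+1 - j.+1) / a ^+ n.+1); split => //.
  - exact: ltnW.
  - move=> i; rewrite /Y first_right_upd// loc_upd_step// (maxn_idPr jl).
    rewrite E /unbump ltn_neqAle eq_sym xNj xj subn1 /=.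
    by move: (a ^- _) (a ^+ (_ - first_right c f)) (a ^+ (_ - j.+1)) => A z w; ring.
  rewrite /Y E (maxn_idPr (ltnW jl)) wE mulrA growth_step; last exact: ltnW.
  by move: (a ^- _) (a ^+ (_ - first_right c f)) (a ^+ (_ - j.+1)) => A z w; ring.
Qed.

End position_martingales.

Arguments growth {R} n.

(** * Concentration of the final position *)

Section real_estimates.
Context {R : realType}.
Implicit Types x y m b : R.

(** For y <= x, the tangent bound gives e^x - e^y = e^x (1 - e^(y - x)) <= e^x (x - y). *)
Lemma dist_expR x y m : x <= m -> y <= m ->
  `|expR x - expR y| <= expR m * `|x - y|.
Proof.
wlog yx : x y / y <= x => [H xm ym|xm _].
  have [/H|/ltW/H h] := leP y x; first exact.
  by rewrite distrC [in leRHS]distrC h.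
rewrite !ger0_norm ?subr_ge0 ?ler_expR//.
apply: (@le_trans _ _ (expR x * (x - y))); last first.
  by rewrite ler_wpM2r ?subr_ge0// ler_expR.
have -> : expR x - expR y = expR x * (1 - expR (y - x)).
  by rewrite mulrBr mulr1 -expRD subrKC.
rewrite ler_wpM2l ?expR_ge0//.
by have := expR_ge1Dx (y - x); lra.
Qed.

Lemma dist_min x y x' y' :
  `|Num.min x y - Num.min x' y'| <= `|x - x'| + `|y - y'|.
Proof.
have xx'1 := ler_norm (x - x'); have yy'1 := ler_norm (y - y').
have xx'2 : x' - x <= `|x - x'| by rewrite distrC ler_norm.
have yy'2 : y' - y <= `|y - y'| by rewrite distrC ler_norm.
have := normr_ge0 (x - x'); have := normr_ge0 (y - y').
by rewrite ler_norml => ? ?; case: (leP x y) => ?; case: (leP x' y') => ?;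
  apply/andP; split; lra.
Qed.

(** The exponent is the limiting fraction of moves that take a card from the right of the inserted
    one; it equals 1 - b, all remaining moves, exactly in the first case of [G]. *)
Lemma GE b y : G b y =
  expR (Num.min (1 - b) ((1 - y) * expR (- b))) - (1 - y) * expR (1 - b).
Proof.
rewrite /G; have -> : (y <= 1 - (1 - b) * expR b) = (1 - b <= (1 - y) * expR (- b)).
  rewrite expRN ler_pdivlMr ?expR_gt0//; apply/idP/idP; lra.
by case: leP => // _; ring.
Qed.

Lemma growthE n : growth n = expR (ln (growth n)) :> R.
Proof. by rewrite lnK// posrE growth_gt0. Qed.

Lemma growthXE n k :
  growth n ^+ k = expR (n.+1%:R * ln (growth n) * (k%:R / n.+1%:R)) :> R.
Proof.
rewrite {1}growthE -expRM_natl; congr expR.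
by field; rewrite ?natr1 ?pnatr_eq0.
Qed.

Lemma ln_growth_le n : n.+1%:R * ln (growth n) <= 1 :> R.
Proof.
rewrite mulrC -ler_pdivlMr// mul1r le_ln1Dx//.
by rewrite (@lt_le_trans _ _ 0)// invr_ge0.
Qed.

(** Apply ln (1 + t) <= t to 1 / a = 1 - 1 / (N + 1), where a is [growth n]. *)
Lemma ln_growth_ge n : 1 - n.+1%:R^-1 <= n.+1%:R * ln (growth n) :> R.
Proof.
have N0 : 0 < n.+1%:R :> R by rewrite ltr0n.
have : ln ((growth n)^-1) <= - (n.+1%:R + 1)^-1 :> R.
  have -> : (growth n)^-1 = 1 + - (n.+1%:R + 1)^-1 :> R.
    rewrite /growth; move: (n.+1%:R) N0 => M M0.
    by field; rewrite !gt_eqF// addr_gt0.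
  by rewrite le_ln1Dx// ltrN2 invf_lt1 ?ltrDr// addr_gt0.
rewrite lnV ?posrE ?growth_gt0// lerN2 => h.
apply: (@le_trans _ _ (n.+1%:R * (n.+1%:R + 1)^-1)); last by rewrite ler_pM2l.
rewrite -subr_ge0; move: (n.+1%:R) N0 => M M0.
have -> : M * (M + 1)^-1 - (1 - M^-1) = (M * (M + 1))^-1.
  by field; rewrite !gt_eqF// addr_gt0.
by rewrite invr_ge0 mulr_ge0 ?addr_ge0// ltW.
Qed.

End real_estimates.

Section concentration.
Context {R : realType} {n : nat}.
Local Notation I := 'I_n.+1.
Local Notation Om := {ffun I -> I}.
Local Notation N := (n.+1%:R).
Local Notation a := (@growth R n).
Variables (c : I) (b : R).
Hypothesis b01 : 0 <= b <= 1.

Let N0 : 0 < N :> R. Proof. by rewrite ltr0n. Qed.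

(** The card [v = first_right c f] is right of [c] and [v - 1] is left of it, so their nearly known
    scaled positions enclose that of [c]; the gap between them costs the extra 1. The minimum covers
    the case where all later cards are on the right. *)
Lemma first_right_estimate (f : Om) (M : R) : 0 <= M ->
  (forall u : I, (c < u)%N ->
    `|(N - (loc f c u)%:R) / a ^+ c - (N - u%:R)| < M) ->
  `|(n.+1 - first_right c f)%:R -
    Num.min (n - c)%:R ((N - (f c)%:R) / a ^+ c)| <= M + 1.
Proof.
move=> M0 good; have [z zE] : exists z : R, z = (N - (f c)%:R) / a ^+ c by eexists.
rewrite -zE; set v := first_right c f.
have aV0 : 0 < (a ^+ c)^-1 by rewrite invr_gt0 exprn_gt0 ?growth_gt0.
have vn : (v <= n.+1)%N := first_right_le c f.
have cv : (c < v)%N := first_right_gt c f.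
have cn : (c <= n)%N by rewrite -ltnS.
have z0 : 0 <= z.
  by rewrite zE mulr_ge0 ?(ltW aV0)// subr_ge0 ler_nat ltnW.
have right (u : I) : (c < u)%N -> (v <= u)%N -> N - u%:R - M < z.
  move=> cu vu; have := good u cu; rewrite ltr_norml => /andP[+ _].
  have : (N - (loc f c u)%:R) / a ^+ c < z.
    by rewrite zE ltr_pM2r// ltrD2l ltrN2 ltr_nat -first_right_loc.
  by move: (_ / _) => D; lra.
have left (u : I) : (c < u)%N -> (u < v)%N -> z < N - u%:R + M.
  move=> cu uv; have := good u cu; rewrite ltr_norml => /andP[_ +].
  have : z <= (N - (loc f c u)%:R) / a ^+ c.
    by rewrite zE ler_pM2r// lerD2l lerN2 ler_nat leqNgt -first_right_loc// -ltnNge.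
  by move: (_ / _) => D; lra.
clearbody v; rewrite !natrB// -?natr1.
have nv : v%:R <= n%:R + 1 :> R by rewrite natr1 ler_nat.
have cv' : c%:R + 1 <= v%:R :> R by rewrite natr1 ler_nat.
have le_z : n%:R + 1 - v%:R <= z + M.
  have [vN|Nv] := ltnP v n.+1.
    by have := right (Ordinal vN) cv (leqnn _); rewrite /= -natr1; lra.
  have : n%:R + 1 <= v%:R :> R by rewrite natr1 ler_nat.
  lra.
(* Either [v = c + 1] and every later card is on the right, or [v - 1] is a later card to which
   [left] applies. *)
have ge_min : n%:R - c%:R <= n%:R + 1 - v%:R :> R \/ z <= n%:R + 1 - v%:R + M + 1.
  have [vc|cv2] := leqP v c.+1.
    left; have : v%:R <= c%:R + 1 :> R by rewrite natr1 ler_nat.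
    lra.
  right; case: v vn cv cv2 right left {nv cv' le_z} => // v vn _ cv2 _ left.
  by have := left (Ordinal vn) cv2 (leqnn _); rewrite /= -!natr1; lra.
rewrite ler_norml; case: (leP (n%:R - c%:R) z) => rz; apply/andP.
  by split; first case: ge_min; lra.
by split; first case: ge_min; lra.
Qed.

(** [c.+1] is the card number counted from 1; the term 1 / N absorbs roundings and the error of N ln
    a against 1. *)
Definition location_error : R := `|c.+1%:R / N - b| + N^-1.
Local Notation eta := location_error.

(** The deterministic part: once both martingales have small deviations, it remains to replace
    powers of [a] by exponentials and [c] by its limit. *)
Lemma scaled_position_estimate (f : Om) (d : R) : 0 <= d ->
  (forall u : I, (c < u)%N ->
    `|(N - (loc f c u)%:R) / a ^+ c - (N - u%:R)| < d * N) ->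
  `|(loc f n.+1 c).+1%:R / a ^+ n.+1 -
    ((N + 1) * a ^+ (n.+1 - first_right c f) - (N - (f c)%:R) * a ^+ (n - c)) /
      a ^+ n.+1| < d * N ->
  `|(loc f n.+1 c).+1%:R / N - G b ((f c)%:R / N)| <= expR 1 * (2 * d + 8 * eta).
Proof.
move=> d0 good1 good2.
have := first_right_estimate (mulr_ge0 d0 (ltW N0)) good1.
move: good2; set P := _.+1%:R; set w := (n.+1 - _)%N => good2 estw.
have [M ME] : exists M : R, M = N by eexists.
have M0 : 0 < M by rewrite ME.
have etaE : eta = `|c.+1%:R / M - b| + M^-1 by rewrite ME.
rewrite -ME in good2 estw *.
pose s : R := 1 - (f c)%:R / M.
have [l lE] : exists l : R, l = N * ln a by eexists.
have l1 : l <= 1 by rewrite lE ln_growth_le.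
have l2 : 1 - M^-1 <= l by rewrite lE ME ln_growth_ge.
have MV0 : 0 < M^-1 :> R by rewrite invr_gt0.
have MV1 : M^-1 <= 1 :> R by rewrite ME invf_le1 ?ltr0n// ler1n.
have l0 : 0 <= l by lra.
have s01 : 0 <= s <= 1.
  rewrite /s subr_ge0 ler_pdivrMr// mul1r ME ler_nat (ltnW (ltn_ord _))/=.
  by rewrite gerBl divr_ge0// ltW.
have aX k : a ^+ k = expR (l * (k%:R / M)) by rewrite growthXE -lE ME.
have frac01 k : (k <= n.+1)%N -> 0 <= k%:R / M <= 1.
  by move=> kN; rewrite divr_ge0 ?(ltW M0)//= ler_pdivrMr// mul1r ME ler_nat.
have lfrac k : (k <= n.+1)%N -> l * (k%:R / M) <= 1.
  by move=> /frac01/andP[k0 k1]; rewrite mulr_ile1.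
have lfrac_dist k : (k <= n.+1)%N -> `|l * (k%:R / M) - k%:R / M| <= M^-1.
  move=> /frac01/andP[k0 k1]; rewrite -[X in _ - X]mul1r -mulrBl normrM.
  rewrite (ger0_norm k0) distrC ger0_norm ?subr_ge0//.
  by apply: (@le_trans _ _ (1 - l)); [rewrite ler_piMr// subr_ge0|lra].
have wn : (w <= n.+1)%N by rewrite leq_subr.
have rn : (n - c <= n.+1)%N by rewrite (leq_trans (leq_subr _ _)).
have cn : (c <= n.+1)%N by rewrite ltnW.
have eta0 : 0 <= `|c.+1%:R / M - b| by [].
have c_dist : `|c%:R / M - b| <= eta.
  have -> : c%:R / M - b = c.+1%:R / M - b + - M^-1 by rewrite -natr1; ring.
  by rewrite (le_trans (ler_normD _ _))// normrN etaE lerD2l gtr0_norm.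
have r_dist : `|(n - c)%:R / M - (1 - b)| <= eta - M^-1.
  have -> : (n - c)%:R / M - (1 - b) = b - c.+1%:R / M :> R.
    rewrite natrB -1?ltnS// -[c.+1%:R]natr1; have := M0; rewrite ME -natr1 => n0.
    by field; rewrite gt_eqF.
  by rewrite distrC etaE addrK.
have b0 : 0 <= b by case/andP: b01.
have b1 : b <= 1 by case/andP: b01.
have expR_c : `|(a ^+ c)^-1 - expR (- b)| <= 2 * eta.
  rewrite aX -expRN (le_trans (dist_expR (m := 0) _ _)) ?expR0 ?mul1r ?oppr_le0//.
    by case/andP: (frac01 c cn) => ? _; rewrite mulr_ge0.
  rewrite -opprD normrN (le_trans (ler_distD (c%:R / M) _ _))//.
  by have := lfrac_dist c cn; have := c_dist; rewrite etaE; lra.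
have est_r : `|a ^+ (n - c) - expR (1 - b)| <= expR 1 * eta.
  rewrite aX (le_trans (dist_expR (m := 1) _ _)) ?lfrac ?gerBl//.
  rewrite ler_pM2l ?expR_gt0// (le_trans (ler_distD ((n - c)%:R / M) _ _))//.
  by have := lfrac_dist _ rn; have := r_dist; lra.
have est_w : `|a ^+ w - expR (Num.min (1 - b) (s * expR (- b)))| <=
    expR 1 * (d + 5 * eta).
  rewrite aX (le_trans (dist_expR (m := 1) _ _)) ?lfrac ?ge_min ?gerBl ?b0//.
  rewrite ler_pM2l ?expR_gt0//.
  have est1 := lfrac_dist _ wn.
  have est2 : `|w%:R / M - Num.min ((n - c)%:R / M) (s / a ^+ c)| <= d + M^-1.
    have -> : s / a ^+ c = (M - (f c)%:R) / a ^+ c / M.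
      rewrite /s; have : 0 < a ^+ c by rewrite exprn_gt0// growth_gt0.
      move: (a ^+ c) => y y0; by field; rewrite !gt_eqF.
    rewrite -minr_pMl ?(ltW MV0)// -mulrBl normrM (gtr0_norm MV0).
    by rewrite ler_pdivrMr// (_ : (d + _) * M = d * M + 1)// mulrDl mulVf ?gt_eqF.
  have est3 := dist_min ((n - c)%:R / M) (s / a ^+ c) (1 - b) (s * expR (- b)).
  have est4 : `|s / a ^+ c - s * expR (- b)| <= 2 * eta.
    rewrite -mulrBr normrM ger0_norm; last by case/andP: s01.
    by rewrite (le_trans _ expR_c)// ler_piMl//; case/andP: s01.
  rewrite (le_trans (ler_distD (w%:R / M) _ _))//.
  have := ler_distD (Num.min ((n - c)%:R / M) (s / a ^+ c)) (w%:R / M)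
    (Num.min (1 - b) (s * expR (- b))).
  by rewrite etaE in r_dist est4 *; lra.
have aN0 : 0 < a ^+ n.+1 by rewrite exprn_gt0// growth_gt0.
have aN1 : a ^+ n.+1 <= expR 1 by rewrite aX ler_expR lfrac.
have aw1 : a ^+ w <= expR 1 by rewrite aX ler_expR lfrac.
have aw0 : 0 < a ^+ w by rewrite exprn_gt0// growth_gt0.
move: good2; set X := _ - _ / a ^+ n.+1 => good2.
(* In order: the martingale deviation, the extra 1 in [N + 1], and the errors in the two powers of
   [a]. *)
have -> : P / M - G b ((f c)%:R / M) = X * (a ^+ n.+1 / M) + a ^+ w / M +
    (a ^+ w - expR (Num.min (1 - b) (s * expR (- b)))) -
    s * (a ^+ (n - c) - expR (1 - b)).
  rewrite GE -/s /X /s; move: (expR _) (expR _) (a ^+ w) (a ^+ (n - c)) => E1 E2 y z.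
  move: (a ^+ n.+1) aN0 (P) ((f c)%:R) => A A0 p k.
  by field; rewrite !gt_eqF.
have h1 : `|X * (a ^+ n.+1 / M)| <= expR 1 * d.
  rewrite normrM (gtr0_norm (divr_gt0 aN0 M0)) mulrA ler_pdivrMr//.
  by rewrite mulrC -mulrA ler_pM ?(ltW aN0)// ltW.
have h2 : `|a ^+ w / M| <= expR 1 * eta.
  rewrite (gtr0_norm (divr_gt0 aw0 M0)) ler_pM ?(ltW aw0) ?(ltW MV0)//.
  by rewrite etaE lerDr.
have h3 : `|s * (a ^+ (n - c) - expR (1 - b))| <= expR 1 * eta.
  rewrite normrM ger0_norm; last by case/andP: s01.
  by rewrite (le_trans _ est_r)// ler_piMl//; case/andP: s01.
rewrite (le_trans (ler_normB _ _))//.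
rewrite (le_trans (lerD (ler_normD _ _) (lexx _)))//.
rewrite (le_trans (lerD (lerD (ler_normD _ _) (lexx _)) (lexx _)))//.
apply: (le_trans (lerD (lerD (lerD h1 h2) est_w) h3)).
rewrite -!mulrDr ler_pM2l ?expR_gt0//.
(* The four bounds add up to 2 d + 7 eta, so one eta is to spare. *)
rewrite -subr_ge0 (_ : _ - _ = eta); last by ring.
by rewrite addr_ge0// invr_ge0.
Qed.

End concentration.

Section concentration_in_probability.
Context {R : realType} {n : nat}.
Local Notation I := 'I_n.+1.
Local Notation Om := {ffun I -> I}.
Local Notation N := (n.+1%:R).
Local Notation a := (@growth R n).
Variables (c : I) (b : R).
Hypothesis b01 : 0 <= b <= 1.

Let N0 : 0 < N :> R. Proof. by rewrite ltr0n. Qed.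

Local Notation eta := (location_error c b).

(** Union bound over the martingale of [c] and those of the later cards: at most N + 1 events, each
    of probability at most 4 / (d^4 N^2) by Markov. *)
Lemma scaled_position_concentration (d : R) : 0 < d ->
  mean (R := R) (fun f : Om => (expR 1 * (2 * d + 8 * eta) <
      `|(loc f n.+1 c).+1%:R / N - G b ((f c)%:R / N)|)%R%:R)
    <= 8 / (d ^+ 4 * N).
Proof.
move=> d0; have dN0 : 0 < d * N by rewrite mulr_gt0.
pose S (u : I) (f : Om) : R := (N - (loc f c u)%:R) / (a ^+ c) - (N - u%:R).
pose T (f : Om) := (loc f n.+1 c).+1%:R / a ^+ n.+1 -
  ((N + 1) * a ^+ (n.+1 - first_right c f) - (N - (f c)%:R) * a ^+ (n - c)) /
  a ^+ n.+1.
have union (f : Om) : (expR 1 * (2 * d + 8 * eta) <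
      `|(loc f n.+1 c).+1%:R / N - G b ((f c)%:R / N)|)%R%:R <=
    (d * N <= `|T f|)%R%:R + \sum_(u : I | (c < u)%N) (d * N <= `|S u f|)%R%:R :> R.
  have [|bad] := leP; first by rewrite addr_ge0// sumr_ge0.
  have [//|T1] := leP (d * N) `|T f|; first by rewrite lerDl sumr_ge0.
  have [/existsP[u /andP[cu Su]]|] :=
      boolP [exists u : I, (c < u)%N && (d * N <= `|S u f|)].
    by rewrite add0r (bigD1 u)//= Su lerDl sumr_ge0.
  move=> /existsPn S1; move: bad; rewrite ltNge scaled_position_estimate// ?ltW//.
  by move=> u cu; have := S1 u; rewrite cu/= -ltNge.
apply: (le_trans (le_mean union)); rewrite meanD mean_sum.
set B : R := 4 * N ^+ 2 / (d * N) ^+ 4.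
have B0 : 0 <= B by rewrite /B ltW// divr_gt0 ?exprn_gt0// mulr_gt0 ?exprn_gt0.
have dN4 : 0 < (d * N) ^+ 4 by rewrite exprn_gt0.
have T4 : mean (fun f => (d * N <= `|T f|)%R%:R) <= B.
  rewrite (le_trans (markov4 _ dN0))// ler_pM2r ?invr_gt0//.
  exact: inserted_fourth_moment.
have S4 (u : I) : (c < u)%N -> mean (fun f => (d * N <= `|S u f|)%R%:R) <= B.
  move=> cu; rewrite (le_trans (markov4 _ dN0))// ler_pM2r ?invr_gt0//.
  exact/unmoved_fourth_moment/ltnW.
apply: (@le_trans _ _ (B + N * B)).
  rewrite lerD// (le_trans (ler_sum _ S4))// sumr_const mulr_natl ler_wpMn2l//.
  by rewrite -[leqRHS](card_ord n.+1) max_card.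
rewrite /B; apply: (@le_trans _ _ (8 * N ^+ 3 / (d * N) ^+ 4)).
  rewrite [N * (_ / _)]mulrA -mulrDl ler_pM2r ?invr_gt0//.
  have : 1 <= N :> R by rewrite ler1n.
  move: (N : R) => x x1; rewrite -subr_ge0.
  have -> : 8 * x ^+ 3 - (4 * x ^+ 2 + x * (4 * x ^+ 2)) = 4 * x ^+ 2 * (x - 1) by ring.
  by rewrite mulr_ge0 ?subr_ge0// mulr_ge0 ?sqr_ge0.
rewrite le_eqVlt; apply/orP; left; apply/eqP.
by field; rewrite !gt_eqF.
Qed.

End concentration_in_probability.

(** * The limit law *)

Section limit_function.
Context {R : realType}.
Variable b : R.

Lemma G_continuous : continuous (G b).
Proof.
rewrite (funext (GE b)) => y.
have cvg1B : (1 - z) @[z --> y] --> 1 - y by apply: cvgB; [exact: cvg_cst|exact: cvg_id].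
apply: cvgB; last by apply: cvgM => //; exact: cvg_cst.
apply: (@continuous_cvg _ _ _ _ _ (fun z => Num.min (1 - b) ((1 - z) * expR (- b)))).
  exact: continuous_expR.
apply: (@continuous_min R R (fun=> 1 - b) (fun z => (1 - z) * expR (- b))).
  exact: cst_continuous.
by apply: cvgM => //; exact: cvg_cst.
Qed.

Lemma measurable_G : measurable_fun setT (G b).
Proof. by apply: continuous_measurable_fun; exact: G_continuous. Qed.

Hypothesis b01 : 0 <= b <= 1.

Lemma G0 : G b 0 = 0.
Proof.
have := expR_ge1Dx (- b); rewrite GE subr0 !mul1r => /min_idPl ->.
exact: subrr.
Qed.

Lemma G1 : G b 1 = 1.
Proof.
rewrite GE subrr !mul0r subr0 (min_idPr _) ?expR0// subr_ge0.
by case/andP: b01.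
Qed.

(** The exponents satisfy m - m' <= (z - y) e^(-b) and m <= 1, so e^m - e^m' stays below (z - y)
    e^(1 - b), the gain of the linear term. If m = m' this is clear; otherwise strictness comes from
    the tangent bound. *)
Lemma G_increasing y z : y < z -> G b y < G b z.
Proof.
move=> yz; rewrite !GE.
have k0 : 0 < expR (- b) := expR_gt0 _.
have eE : expR (1 - b) = expR 1 * expR (- b) by rewrite -expRD.
set m := Num.min (1 - b) ((1 - y) * expR (- b)).
set m' := Num.min (1 - b) ((1 - z) * expR (- b)).
have zy : (1 - z) * expR (- b) <= (1 - y) * expR (- b).
  by rewrite ler_pM2r// lerD2l lerN2 ltW.
have m'm : m' <= m by rewrite /m /m' le_min ge_min lexx/= ge_min zy orbT.
have m1 : m <= 1.
  by rewrite (@le_trans _ _ (1 - b)) ?ge_min ?lexx// gerBl; case/andP: b01.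
have mm' : m - m' <= (z - y) * expR (- b).
  have -> : (z - y) * expR (- b) = (1 - y) * expR (- b) - (1 - z) * expR (- b) by ring.
  rewrite /m /m'; move: ((1 - y) * _) ((1 - z) * _) zy => p q qp.
  by case: (leP (1 - b) p) => ?; case: (leP (1 - b) q) => ?; lra.
have e0 : 0 < expR 1 :> R := expR_gt0 _.
suff : expR m - expR m' < expR 1 * ((z - y) * expR (- b)) by rewrite eE; lra.
have [<-|mm'0] := eqVneq m' m.
  by rewrite subrr !mulr_gt0 ?subr_gt0.
apply: (@lt_le_trans _ _ (expR m * (m - m'))).
  have -> : expR m - expR m' = expR m * (1 - expR (m' - m)).
    by rewrite mulrBr mulr1 -expRD subrKC.
  rewrite ltr_pM2l ?expR_gt0//.
  by have := @expR_gt1Dx R (m' - m); rewrite subr_eq0 => /(_ mm'0); lra.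
by rewrite ler_pM ?expR_ge0 ?ler_expR ?subr_ge0.
Qed.

Lemma G_le y z : (G b y <= G b z) = (y <= z).
Proof.
have [yz|zy|->] := ltgtP y z; rewrite ?lexx//.
  by rewrite ltW// G_increasing.
by apply/negbTE; rewrite -ltNge G_increasing.
Qed.

Lemma G_bij01 : set_bij `[0, 1] `[0, 1] (G b).
Proof.
split.
- move=> y /=; rewrite !in_itv/= => /andP[y0 y1].
  by rewrite -[X in X <= _]G0 -[X in _ && (_ <= X)]G1 !G_le y0.
- by move=> y z _ _ Gyz; apply/eqP; rewrite eq_le -(G_le y z) -(G_le z y) Gyz lexx.
- move=> x /= x01; have [y y01 <-] : exists2 y, y \in `[0, 1] & G b y = x.
    apply: IVT => //; first by move=> y; exact/continuous_subspaceT/G_continuous.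
    by rewrite G0 G1 (min_idPl ler01) (max_idPr ler01); move: x01; rewrite in_itv.
  by exists y.
Qed.

End limit_function.

(* uniform_prob lives on measurableTypeR R, which has the same measurable sets
   as R but another display. *)
Definition G_rv (R : realType) (b : R) : measurableTypeR R -> R := G b.

HB.instance Definition _ (R : realType) (b : R) :=
  isMeasurableFun.Build _ _ (measurableTypeR R) R (G_rv b) (@measurable_G R b).

Section limit_law.
Context {R : realType}.
Variable b : R.
Hypothesis b01 : 0 <= b <= 1.

Definition limit_law : probability R R :=
  distribution (uniform_prob (@ltr01 R)) (G_rv b).

(** As [G b] is increasing, G_b(U) <= G_b(y) means U <= y for the uniform variable U. *)
Lemma limit_law_cdf (y : R) : y \in `[0, 1] -> limit_law `]-oo, G b y]%classic = y%:E.
Proof.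
rewrite in_itv/= => /andP[y0 y1].
rewrite /limit_law /distribution /pushforward/= /G_rv /uniform_prob integral_uniform_pdf.
have -> : G b @^-1` `]-oo, G b y]%classic `&` `[0, 1]%classic = `[0, y]%classic.
  apply/seteqP; split => x /=; rewrite !in_itv/= G_le//.
    by case=> xy /andP[-> _].
  by case/andP=> x0 xy; rewrite x0 (le_trans xy).
rewrite (eq_integral (fun=> 1%:E)).
  by rewrite integral_cst//= lebesgue_measure_itv/= mul1e lte_fin;
    case: ltgtP y0 => // [? _|<- _]; rewrite -?EFinB ?subr0.
move=> x; rewrite inE/= in_itv/= => /andP[x0 xy].
by rewrite /uniform_pdf x0 (le_trans xy)//= subr0 invr1.
Qed.

End limit_law.

Lemma card_cyclicE (R : realType) n (P : pred 'S_n.+1) :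
  card_cyclic R (1%g : 'S_n.+1) [set s | P s] =
  (mean (R := R) (fun f => (P (shuffle 1 f))%:R))%:E.
Proof.
rewrite /card_cyclic /mean mulr_sumr -sumEFin; apply: eq_bigr => f _.
rewrite diracE EFinM; congr (_ * (_ %:R)%:E)%E.
by rewrite /in_mem /= /in_set /= asboolb.
Qed.

Lemma position_shuffle n (c : 'I_n.+1) f :
  position c (shuffle 1 f) = (loc f n.+1 c).+1.
Proof. by rewrite /position /loc shuffle_deck. Qed.

(** * Convergence of the distribution functions *)

Section cdf_limit.
Context {R : realType}.
Local Notation I n := ('I_n.+1).
Local Notation Om n := {ffun 'I_n.+1 -> 'I_n.+1}.

(** With k the integer part of z N, the number of favourable [i] lies between k and k + 1. *)
Lemma mean_ord_lt n (z : R) : 0 <= z <= 1 ->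
  `|mean (fun i : I n => (i%:R / n.+1%:R < z)%R%:R) - z| <= n.+1%:R^-1.
Proof.
case/andP=> z0 z1; have N0 : 0 < n.+1%:R :> R by rewrite ltr0n.
have zN0 : 0 <= z * n.+1%:R by rewrite mulr_ge0.
have /andP[kz zk] := truncn_itv zN0; set k := Num.truncn _ in kz zk.
have kn : (k <= n.+1)%N.
  by rewrite -(ler_nat R) (le_trans kz)// ler_piMl.
have countE m : (m <= n.+1)%N -> \sum_(i < n.+1) (i < m)%N%:R = m%:R :> R.
  move=> mn; rewrite -natr_sum; congr _%:R.
  rewrite (eq_bigr (fun i : I n => if (i < m)%N then 1 else 0)%N); last first.
    by move=> i _; case: ifP.
  by rewrite -big_mkcond -(big_ord_widen _ (fun=> 1%N))// sum1_card card_ord.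
have lo : k%:R <= \sum_(i < n.+1) (i%:R / n.+1%:R < z)%R%:R :> R.
  rewrite -(countE k kn); apply: ler_sum => i _; rewrite ltr_pdivrMr//.
  case: ltnP => //= ik; rewrite (lt_le_trans _ kz) ?ltr_nat//.
have hi : \sum_(i < n.+1) (i%:R / n.+1%:R < z)%R%:R <= k%:R + 1 :> R.
  have [kn1|nk] := leqP k.+1 n.+1.
    rewrite natr1 -(countE k.+1 kn1); apply: ler_sum => i _; rewrite ltr_pdivrMr//.
    by case: ltP => //= iz; rewrite -(ltr_nat R) (lt_trans iz zk).
  (* Here k = N, and the trivial bound by the number of all [i] suffices. *)
  rewrite (@le_trans _ _ n.+1%:R)//; last by rewrite natr1 ler_nat ltnW.
  rewrite -[leRHS](countE n.+1 (leqnn _)); apply: ler_sum => i _.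
  by rewrite ltn_ord; case: (_ < z).
rewrite /mean card_ord; move: (\sum_(i < _) _) lo hi => s lo hi.
have -> : n.+1%:R^-1 * s - z = n.+1%:R^-1 * (s - z * n.+1%:R).
  by move: (n.+1%:R) N0 => M M0; field; rewrite gt_eqF.
rewrite normrM gtr0_norm ?invr_gt0// ler_piMr ?invr_ge0// ler_norml.
by move: (z * _) kz zk => x kz zk; rewrite -natr1 in zk; apply/andP; split; lra.
Qed.

Context (b_ : nat -> R) (b : R) (c : forall n : nat, I n).
Hypothesis hc : forall n : nat, b_ n.+1 * n.+1%:R = (c n).+1%:R.
Hypothesis hb : b_ n @[n --> \oo] --> b.
Hypothesis b01 : 0 <= b <= 1.

Let near_inv (e : R) : 0 < e -> \forall n \near \oo, n.+1%:R^-1 <= e.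
Proof.
by move=> e0; near do apply/ltW; exact: (near_infty_natSinv_lt (PosNum e0)).
Unshelve. all: end_near. Qed.

Lemma location_error_near (e : R) : 0 < e ->
  \forall n \near \oo, location_error (c n) b <= e.
Proof.
move=> e0; have e20 : 0 < e / 2 by rewrite divr_gt0.
(* Index [n] stands for a deck of [n.+1] cards, hence the shifted sequence. *)
have hbS : b_ n.+1 @[n --> \oo] --> b by have := hb; rewrite -cvg_shiftS.
near=> n; rewrite /location_error -hc mulfK ?pnatr_eq0//.
rewrite [leRHS](splitr e) lerD//.
  by rewrite distrC; near: n; exact: cvgr_dist_le.
by near: n; exact: near_inv.
Unshelve. all: end_near. Qed.

Definition bad_mean (e : R) n : R :=
  mean (fun f : Om n => (e < `|(position (c n) (shuffle 1 f))%:R / n.+1%:R -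
    G b ((f (c n))%:R / n.+1%:R)|)%R%:R).

Lemma bad_mean_near (e e' : R) : 0 < e -> 0 < e' ->
  \forall n \near \oo, bad_mean e n <= e'.
Proof.
move=> e0 e'0; have E0 : 0 < expR 1 :> R := expR_gt0 1.
(* Chosen so that e is expR 1 times 2 d + 2 d; the second 2 d dominates 8 times the location error
   once that error is at most d / 4. *)
pose d : R := e / (4 * expR 1); have d0 : 0 < d by rewrite divr_gt0 ?mulr_gt0.
have eE : e = expR 1 * (4 * d) by rewrite /d; field; rewrite gt_eqF.
have d4 : 0 < d ^+ 4 by rewrite exprn_gt0.
near=> n; have N0 : 0 < n.+1%:R :> R by rewrite ltr0n.
apply: (@le_trans _ _ (8 / (d ^+ 4 * n.+1%:R))); last first.
  rewrite invfM mulrA -ler_pdivlMl ?divr_gt0//.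
  by near: n; apply: near_inv; rewrite mulr_gt0 ?invr_gt0 ?divr_gt0.
apply: le_trans (scaled_position_concentration (c n) b01 d0).
apply: le_mean => f; rewrite position_shuffle.
case: ltP => //= elt; rewrite (le_lt_trans _ elt)// eE ler_pM2l//.
suff : location_error (c n) b <= d / 4 by lra.
by near: n; apply: location_error_near; rewrite divr_gt0.
Unshelve. all: end_near. Qed.

Let cdf_mean (x : R) n : R :=
  mean (fun f : Om n => ((position (c n) (shuffle 1 f))%:R <= x * n.+1%:R)%R%:R).

Let mean_first n (z : R) :
  mean (R := R) (fun f : Om n => ((f (c n))%:R / n.+1%:R < z)%R%:R) =
  mean (fun i : I n => (i%:R / n.+1%:R < z)%R%:R).
Proof. exact: (mean_proj (c n) (fun i : I n => (i%:R / n.+1%:R < z)%R%:R)). Qed.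

(** If the final position is at most G_b(y), then [c] was inserted below y + e / 3, or the position
    misses G_b of the insertion point by the whole gap G_b(y + e / 3) - G_b(y), which has small
    probability. The other two thirds of e pay for rounding and for that event. *)
Lemma cdf_mean_upper (y e : R) : 0 <= y <= 1 -> 0 < e ->
  \forall n \near \oo, cdf_mean (G b y) n <= y + e.
Proof.
move=> /andP[y0 y1] e0; have e30 : 0 < e / 3 by rewrite divr_gt0.
have [y1e|ye1] := leP 1 (y + e / 3).
  apply: nearW => n; rewrite (le_trans (mean_indicator_le1 _ _))//; last by lra.
  exact: [ffun=> ord0].
have g0 : 0 < (G b (y + e / 3) - G b y) / 2.
  by rewrite divr_gt0// subr_gt0 G_increasing// ltrDl.
near=> n; have N0 : 0 < n.+1%:R :> R by rewrite ltr0n.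
apply: (@le_trans _ _ (mean (R := R)
    (fun f : Om n => ((f (c n))%:R / n.+1%:R < y + e / 3)%R%:R) + bad_mean ((G b (y + e / 3) - G b y) / 2) n)).
  rewrite -meanD; apply: le_mean => f.
  rewrite -ler_pdivrMr//.
  case: (leP ((position (c n) (shuffle 1 f))%:R / n.+1%:R) (G b y)) => /= Px;
    last by rewrite addr_ge0.
  case: (ltP ((f (c n))%:R / n.+1%:R) (y + e / 3)) => /= fy; first by rewrite lerDl.
  rewrite add0r ltr_normr; set u := _ / _ in Px *; set v := _ / _ in fy *.
  have : G b (y + e / 3) <= G b v by rewrite G_le.
  by move=> Gv; rewrite [X in _ || X](_ : _ = true) ?orbT//; lra.
have [r n1 rE] : exists2 r, r <= e / 3 & n.+1%:R^-1 = r.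
  by exists n.+1%:R^-1 => //; near: n; exact: near_inv.
have n2 : bad_mean ((G b (y + e / 3) - G b y) / 2) n <= e / 3.
  by near: n; exact: bad_mean_near.
rewrite mean_first; have := @mean_ord_lt n (y + e / 3).
have -> : 0 <= y + e / 3 <= 1 by rewrite (ltW ye1) addr_ge0// ltW.
move=> /(_ isT); rewrite rE ler_norml => /andP[_].
by move: n2; move: (bad_mean _ _) (mean _) => p q; lra.
Unshelve. all: end_near. Qed.

Lemma cdf_mean_lower (y e : R) : 0 <= y <= 1 -> 0 < e ->
  \forall n \near \oo, y - e <= cdf_mean (G b y) n.
Proof.
move=> /andP[y0 y1] e0; have e30 : 0 < e / 3 by rewrite divr_gt0.
have [y1e|ye1] := leP (y - e / 3) 0.
  apply: nearW => n; apply: (@le_trans _ _ 0); first by lra.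
  by rewrite /cdf_mean /mean mulr_ge0 ?invr_ge0// sumr_ge0.
have g0 : 0 < (G b y - G b (y - e / 3)) / 2.
  by rewrite divr_gt0// subr_gt0 G_increasing// gtrBl.
near=> n; have N0 : 0 < n.+1%:R :> R by rewrite ltr0n.
have : mean (R := R) (fun f : Om n => ((f (c n))%:R / n.+1%:R < y - e / 3)%R%:R) <=
    cdf_mean (G b y) n + bad_mean ((G b y - G b (y - e / 3)) / 2) n.
  rewrite -meanD; apply: le_mean => f.
  case: (ltP ((f (c n))%:R / n.+1%:R) (y - e / 3)) => /= fy; last by rewrite addr_ge0.
  rewrite -ler_pdivrMr//.
  case: (leP ((position (c n) (shuffle 1 f))%:R / n.+1%:R) (G b y)) => /= Px;
    first by rewrite lerDl.
  rewrite add0r ltr_normr; set u := _ / _ in Px *; set v := _ / _ in fy *.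
  have : G b v <= G b (y - e / 3) by rewrite G_le// ltW.
  by move=> Gv; rewrite [X in X || _](_ : _ = true)//; lra.
have [r n1 rE] : exists2 r, r <= e / 3 & n.+1%:R^-1 = r.
  by exists n.+1%:R^-1 => //; near: n; exact: near_inv.
have n2 : bad_mean ((G b y - G b (y - e / 3)) / 2) n <= e / 3.
  by near: n; exact: bad_mean_near.
rewrite mean_first; have := @mean_ord_lt n (y - e / 3).
have -> : 0 <= y - e / 3 <= 1 by rewrite (ltW ye1) (le_trans _ y1)// gerBl ltW.
move=> /(_ isT); rewrite rE ler_norml => /andP[+ _].
by move: n2; move: (bad_mean _ _) (mean _) (cdf_mean _ _) => p q s; lra.
Unshelve. all: end_near. Qed.

Lemma cdf_limit (y : R) : y \in `[0, 1] ->
  card_cyclic R (1%g : 'S_n.+1)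
    [set s | (position (c n) s)%:R <= G b y * n.+1%:R] @[n --> \oo] --> y%:E.
Proof.
rewrite in_itv/= => y01; under eq_fun => n do rewrite card_cyclicE.
apply: cvg_EFin; first exact: nearW.
apply/cvgrPdist_le => e e0; near=> n; rewrite /= -/(cdf_mean (G b y) n).
have lo : y - e <= cdf_mean (G b y) n by near: n; exact: cdf_mean_lower.
have hi : cdf_mean (G b y) n <= y + e by near: n; exact: cdf_mean_upper.
by rewrite ler_norml; apply/andP; split; lra.
Unshelve. all: end_near. Qed.

End cdf_limit.

(** * Weak convergence *)

Section weak_convergence.
Context {R : realType}.
Implicit Types (P : probability R R) (f : R -> R).

Let cdf01 P x : R := fine (P `]-oo, x]%classic).

Lemma bounded_probability_integrable P f (A : set R) : measurable A ->
  continuous f -> bounded_fun f -> P.-integrable A (EFin \o f).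
Proof.
move=> mA cf bf; apply: measurable_bounded_integrable => //.
- by rewrite (le_lt_trans (probability_le1 _ _))// ltry.
- by apply: measurable_funTS; exact: continuous_measurable_fun.
- apply: filterS bf => M fM x _; exact: fM.
Qed.

Lemma Rintegral_dist_cst P f (A : set R) (v e : R) : measurable A ->
  continuous f -> bounded_fun f -> (forall x, A x -> `|v - f x| <= e) ->
  `|(\int[P]_(x in A) f x)%R - v * fine (P A)| <= e * fine (P A).
Proof.
move=> mA cf bf fv; have intf := bounded_probability_integrable P mA cf bf.
have intc (r : R) : P.-integrable A (EFin \o cst r).
  exact: finite_measure_integrable_cst.
have lo : (v - e) * fine (P A) <= (\int[P]_(x in A) f x)%R.
  rewrite -(@Rintegral_cst _ _ _ P A mA); apply: le_Rintegral => //; first exact: intc.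
  move=> x Ax /=.
  by have := fv x Ax; rewrite ler_norml => /andP[_]; lra.
have hi : (\int[P]_(x in A) f x)%R <= (v + e) * fine (P A).
  rewrite -(@Rintegral_cst _ _ _ P A mA); apply: le_Rintegral => //; first exact: intc.
  move=> x Ax /=.
  by have := fv x Ax; rewrite ler_norml => /andP[+ _]; lra.
rewrite ler_norml; apply/andP; split; lra.
Qed.

Lemma Rintegral_null0 P f (A : set R) : measurable A -> continuous f ->
  P A = 0%E -> (\int[P]_(x in A) f x)%R = 0.
Proof.
move=> mA cf PA; rewrite /Rintegral null_set_integral//.
by apply/measurable_EFinP/measurable_funTS; exact: continuous_measurable_fun.
Qed.

(** A Riemann-Stieltjes sum for a law on ]0, 1]: [f] varies by at most [e] on each cell, and the
    cells have total mass 1. *)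
Lemma Rintegral_riemann P f (k : nat) (e : R) :
  continuous f -> bounded_fun f ->
  P `]-oo, 0]%classic = 0%E -> P `]-oo, 1]%classic = 1%E ->
  (forall (j : nat) x, j%:R / k.+1%:R < x <= j.+1%:R / k.+1%:R ->
    (j < k.+1)%N -> `|f (j.+1%:R / k.+1%:R) - f x| <= e) ->
  `|(\int[P]_x f x)%R - \sum_(j < k.+1) f (j.+1%:R / k.+1%:R) *
     (cdf01 P (j.+1%:R / k.+1%:R) - cdf01 P (j%:R / k.+1%:R))| <= e.
Proof.
move=> cf bf P0 P1 fe; pose t (j : nat) : R := j%:R / k.+1%:R.
have int := fun A mA => @bounded_probability_integrable P f A mA cf bf.
have tS j : t j <= t j.+1 by rewrite ler_pM2r// ler_nat.
have splitE j : `]-oo, t j.+1]%classic =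
    `]-oo, t j]%classic `|` `]t j, t j.+1]%classic :> set R.
  apply/seteqP; split => x /=; rewrite !in_itv/=.
    by case: (leP x (t j)) => /= xt h; [left|right].
  by case=> [/le_trans -> //|/andP[]].
have disjE j : [disjoint `]-oo, t j]%classic & `]t j, t j.+1]%classic].
  apply/eqP/seteqP; split => x //= [] /=; rewrite !in_itv/= => xt /andP[tx _].
  by move: (lt_le_trans tx xt); rewrite ltxx.
have cdfS j : fine (P `]t j, t j.+1]%classic) = cdf01 P (t j.+1) - cdf01 P (t j).
  rewrite /cdf01 splitE measureU//; last exact/eqP/disjE.
  by rewrite fineD ?fin_num_measure// addrAC subrr add0r.
have main m : (m <= k.+1)%N ->
    `|(\int[P]_(x in `]-oo, t m]) f x)%R -
      \sum_(j < m) f (t j.+1) * (cdf01 P (t j.+1) - cdf01 P (t j))| <=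
    e * cdf01 P (t m).
  elim: m => [_|m IH mk].
    rewrite big_ord0 subr0 /t mul0r /cdf01 P0/= mulr0.
    by rewrite Rintegral_null0// normr0.
  rewrite big_ord_recr/= splitE Rintegral_setU//; last by rewrite -splitE; exact: int.
  rewrite opprD addrACA (le_trans (ler_normD _ _))//.
  have -> : e * cdf01 P (t m.+1) =
      e * cdf01 P (t m) + e * (cdf01 P (t m.+1) - cdf01 P (t m)) by ring.
  rewrite lerD ?(IH (ltnW mk))// -cdfS Rintegral_dist_cst// => x.
  by rewrite /= in_itv/= => /fe; exact.
have t1 : t k.+1 = 1 by rewrite /t divff// pnatr_eq0.
have c1 : cdf01 P 1 = 1 by rewrite /cdf01 P1.
have := main k.+1 (leqnn _); rewrite t1 c1 mulr1.
suff -> : (\int[P]_x f x)%R = (\int[P]_(x in `]-oo, 1%R]) f x)%R by [].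
rewrite -(@setUv _ `]-oo, 1%R]%classic) Rintegral_setU//; last 2 first.
- by rewrite setUv; exact: int.
- by apply/eqP; rewrite setICr.
rewrite [X in _ + X]Rintegral_null0 ?addr0//; first exact: measurableC.
  by rewrite probability_setC// P1 subee.
exact: measurableC.
Qed.

(** Compactness in its near-covering form: around each x a ball of half the radius of continuity,
    together with a mesh below that half radius. *)
Lemma uniform_continuity01 f (e : R) : continuous f -> 0 < e ->
  exists k : nat, forall x y, 0 <= x <= 1 -> `|x - y| <= k.+1%:R^-1 ->
    `|f x - f y| <= e.
Proof.
move=> cf e0; have e20 : 0 < e / 2 by rewrite divr_gt0.
have /compact_near_coveringP cov := @segment_compact R 0 1.
have := cov nat \oo (fun k x => forall y, `|x - y| <= k.+1%:R^-1 ->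
  `|f x - f y| <= e) _.
case=> [x _|k _ /(_ k (leqnn k)) kP]; last first.
  by exists k => x y x01; apply: kP; rewrite /= in_itv.
have : nbhs x (fun z => `|f x - f z| <= e / 2) by exact: cvgr_dist_le (cf x) _ e20.
move=> /nbhs_ballP[r /= r0 fr].
have r20 : 0 < r / 2 by rewrite divr_gt0.
exists ([set y | `|x - y| < r / 2], [set k : nat | k.+1%:R^-1 < r / 2]).
  split => /=; first exact: nbhsx_ballx.
  exact: (near_infty_natSinv_lt (PosNum r20)).
move=> [z k] /= [xz kr] y zy.
have fz : `|f x - f z| <= e / 2 by apply: fr; rewrite /ball/=; lra.
have fy : `|f x - f y| <= e / 2.
  apply: fr; rewrite /ball/= (le_lt_trans (ler_distD z _ _))//.
  have := le_lt_trans zy kr; lra.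
by rewrite (le_trans (ler_distD (f x) _ _))// distrC; lra.
Qed.

(** Each integral is within e / 3 of its Riemann-Stieltjes sum on a common mesh, and such a sum is a
    finite combination of values of the distribution function, hence converges. *)
Lemma weak_cvg_cdf (mu_ : nat -> probability R R) (mu : probability R R) :
  (forall n, mu_ n `]-oo, 0]%classic = 0%E /\ mu_ n `]-oo, 1]%classic = 1%E) ->
  mu `]-oo, 0]%classic = 0%E -> mu `]-oo, 1]%classic = 1%E ->
  (forall x : R, 0 <= x <= 1 ->
    mu_ n `]-oo, x]%classic @[n --> \oo] --> mu `]-oo, x]%classic) ->
  weak_cvg mu_ mu.
Proof.
move=> mu_01 mu0 mu1 cvg_cdf f cf bf.
have int P := @bounded_probability_integrable P f setT measurableT cf bf.
have fin P : (\int[P]_x (f x)%:E)%E \is a fin_num.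
  exact: integrable_fin_num (int P).
rewrite -[X in _ --> X]fineK//; apply: cvg_EFin; first exact: nearW.
apply/cvgrPdist_le => e e0; have e30 : 0 < e / 3 by rewrite divr_gt0.
have [k kP] := uniform_continuity01 cf e30.
have osc (j : nat) x : j%:R / k.+1%:R < x <= j.+1%:R / k.+1%:R ->
    (j < k.+1)%N -> `|f (j.+1%:R / k.+1%:R) - f x| <= e / 3.
  move=> /andP[jx xj] jk; apply: kP.
    by rewrite divr_ge0//= ler_pdivrMr// mul1r ler_nat.
  rewrite ger0_norm ?subr_ge0// lerBlDr -lerBlDl (le_trans _ (ltW jx))//.
  by rewrite -natr1 mulrDl mul1r addrK.
pose S P := \sum_(j < k.+1) f (j.+1%:R / k.+1%:R) *
  (cdf01 P (j.+1%:R / k.+1%:R) - cdf01 P (j%:R / k.+1%:R)).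
have cvgS : S (mu_ n) @[n --> \oo] --> S mu.
  have cvgt (j : nat) : (j <= k.+1)%N ->
      cdf01 (mu_ n) (j%:R / k.+1%:R) @[n --> \oo] --> cdf01 mu (j%:R / k.+1%:R).
    move=> jk; apply: fine_cvg; rewrite fineK ?fin_num_measure//.
    by apply: cvg_cdf; rewrite divr_ge0//= ler_pdivrMr// mul1r ler_nat.
  apply: cvg_big => [|j _]; first exact: add_continuous.
  apply: cvgM; first exact: cvg_cst.
  by apply: cvgB; apply: cvgt => //; exact: ltnW.
near=> n; have [mun0 mun1] := mu_01 n.
have h1 := Rintegral_riemann cf bf mun0 mun1 osc.
have h2 := Rintegral_riemann cf bf mu0 mu1 osc.
have h3 : `|S mu - S (mu_ n)| <= e / 3 by near: n; exact: cvgr_dist_le.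
rewrite -/(S _) in h1; rewrite -/(S _) in h2; rewrite /=.
move: h1 h2 h3; rewrite /Rintegral !ler_norml => /andP[? ?] /andP[? ?] /andP[? ?].
by apply/andP; split; lra.
Unshelve. all: end_near. Qed.

End weak_convergence.

Lemma distribution_scaled_position (R : realType) n (c : 'I_n.+1) (x : R) :
  distribution (card_cyclic R (1%g : 'S_n.+1)) (@scaled_position R n c)
    `]-oo, x]%classic =
  card_cyclic R (1%g : 'S_n.+1) [set s | (position c s)%:R <= x * n.+1%:R].
Proof.
rewrite /distribution /pushforward/=; congr (card_cyclic _ _ _).
apply/seteqP; split => s /=.
  by rewrite in_itv/= /scaled_position ler_pdivrMr.
by rewrite in_itv/= /scaled_position ler_pdivrMr.
Qed.

Theorem theorem4 (R : realType) (b_ : nat -> R) (b : R)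
    (c : forall n : nat, 'I_n.+1)
    (hc : forall n : nat, b_ n.+1 * n.+1%:R = (c n).+1%:R)
    (hb : b_ n @[n --> \oo] --> b)
    (b01 : 0 <= b <= 1) :
  exists (mu : probability R R) (F : R -> R),
    [/\ weak_cvg
          (fun n => distribution (card_cyclic R (1%g : 'S_n.+1))
                      (@scaled_position R n (c n))) mu,
        (forall x : R, x \in `[0, 1] -> mu `]-oo, x]%classic = (F x)%:E),
        (forall x : R, x \in `[0, 1] ->
          card_cyclic R (1%g : 'S_n.+1)
            [set s | (position (c n) s)%:R <= x * n.+1%:R] @[n --> \oo]
          --> (F x)%:E),
        set_bij `[0, 1] `[0, 1] (G b)
      & [/\ set_bij `[0, 1] `[0, 1] F,
            {in `[0, 1], cancel (G b) F}
          & {in `[0, 1], cancel F (G b)}]].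
Proof.
have [_ _ Gsurj] := G_bij01 b01.
have [G0b G1b] := (G0 b, G1 b01).
(* [limit_law_cdf] makes [F] a left inverse of [G b], and surjectivity of [G b] turns it into a
   two-sided one. *)
pose mu := limit_law b; pose F x : R := fine (mu `]-oo, x]%classic).
have FG : {in `[0, 1], cancel (G b) F}.
  by move=> y y01; rewrite /F /mu limit_law_cdf.
have muF x : x \in `[0, 1] -> mu `]-oo, x]%classic = (F x)%:E.
  by move=> _; rewrite /F fineK// fin_num_measure.
have GF : {in `[0, 1], cancel F (G b)}.
  by move=> x /Gsurj[y y01 <-]; rewrite FG.
have F01 x : x \in `[0, 1] -> F x \in `[0, 1].
  by move=> /Gsurj[y y01 <-]; rewrite FG.
have cdf_cvg x : x \in `[0, 1] ->
    card_cyclic R (1%g : 'S_n.+1)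
      [set s | (position (c n) s)%:R <= x * n.+1%:R] @[n --> \oo] --> (F x)%:E.
  move=> x01; have := cdf_limit hc hb b01 (F01 x x01).
  by rewrite GF.
exists mu, F; split => //; last first.
- split => //; split.
  + exact: F01.
  + by move=> x y; rewrite !inE => x01 y01 /(congr1 (G b)); rewrite !GF.
  + move=> y /= y01; exists (G b y); last exact: FG.
    by case: (G_bij01 b01) => Gfun _ _; exact: Gfun.
- exact: G_bij01.
apply: weak_cvg_cdf.
- move=> n; have cdfE := @distribution_scaled_position R n (c n); split.
    apply: eq_trans (cdfE 0) _.
    (* Positions are counted from 1, so no card has scaled position 0. *)
    have -> : [set s | (position (c n) s)%:R <= 0 * n.+1%:R :> R] = set0.
      by apply/seteqP; split => s //=; rewrite mul0r lern0.
    exact: measure0.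
  apply: eq_trans (cdfE 1) _.
  have -> : [set s | (position (c n) s)%:R <= 1 * n.+1%:R :> R] = setT.
    by apply/seteqP; split => s //= _; rewrite mul1r ler_nat ltn_ord.
  exact: probability_setT.
- by rewrite -G0b limit_law_cdf// in_itv/= lexx ler01.
- by rewrite -{1}G1b limit_law_cdf// in_itv/= lexx ler01.
- move=> x x01; have {}x01 : x \in `[0, 1] by rewrite in_itv.
  rewrite muF//; apply: cvg_trans (cdf_cvg x x01); apply: near_eq_cvg.
  by apply: nearW => n; exact/esym/distribution_scaled_position.
Qed.
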